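(* Let $n\geq 2$ be an integer, let $|\cdot|$ be an arbitrary norm on $\mathbb R^n$ induced by an inner product, let $\alpha\in\mathbb R^n\setminus\mathbb Q^n$, and let $1=q_1<q_2<q_3<\cdots$ be the sequence of denominators of simultaneous best approximations to $\alpha$ with respect to $|\cdot|$. Then for every integer $k\geq 1$, $$q_{k+2^n}\geq q_k+\min\{q_{k+2^{n-1}},\,2q_{k+1}\}.$$
   Context: The norm is $|x|=\sqrt{\langle x,x\rangle}$ for an arbitrary inner product $\langle\cdot,\cdot\rangle$ on $\mathbb R^n$. For $\alpha\in\mathbb R^n\setminus\mathbb Q^n$ and a positive integer $q$, set $\delta_q=\min_{\mathbf p\in\mathbb Z^n}|q\alpha-\mathbf p|$. The denominators of best approximations are the increasing (infinite) sequence $1=q_1<q_2<q_3<\cdots$ consisting of all positive integers $q$ such that $\delta_t>\delta_q$ for every integer $t$ with $0<t<q$. *)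

(* Defs.v *)
From mathcomp Require Import all_boot all_order all_algebra.
From mathcomp Require Import sesquilinear classical_sets reals.
From mathcomp Require Import zify lra.

Set Implicit Arguments.
Unset Strict Implicit.
Unset Printing Implicit Defensive.

Import Order.TTheory GRing.Theory Num.Theory.

Local Open Scope classical_set_scope.
Local Open Scope ring_scope.

(* The norm induced by an inner product.  With [theta := idfun], [Dot.type] is
   the type of symmetric, positive definite bilinear forms. *)
Definition inner_norm (R : realType) (n : nat)
    (dot : {dot 'rV[R]_n for idfun}) (x : 'rV[R]_n) : R :=
  Num.sqrt (dot x x).

Definition rational_point (R : realType) (n : nat) (alpha : 'rV[R]_n) : Prop :=
  exists r : 'rV[rat]_n, alpha = map_mx ratr r.

Definition lattice_dists (R : realType) (n : nat)
    (dot : {dot 'rV[R]_n for idfun}) (alpha : 'rV[R]_n) (q : nat) : set R :=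
  [set inner_norm dot (q%:R *: alpha - map_mx intr p) | p in [set: 'rV[int]_n]].

(* The minimum of |q alpha - p| over integer points p.  It is written as an
   infimum, which is attained: see [delta_attained] and [delta_le]. *)
Definition delta (R : realType) (n : nat)
    (dot : {dot 'rV[R]_n for idfun}) (alpha : 'rV[R]_n) (q : nat) : R :=
  inf (lattice_dists dot alpha q).

Definition best_denominator (R : realType) (n : nat)
    (dot : {dot 'rV[R]_n for idfun}) (alpha : 'rV[R]_n) (q : nat) : Prop :=
  (0 < q)%N /\
  forall t : nat, (0 < t)%N -> (t < q)%N -> delta dot alpha q < delta dot alpha t.

(* [q 1 < q 2 < ...] enumerates all best denominators; the value [q 0] is
   irrelevant.  Since 1 is always a best denominator, [q 1 = 1] follows. *)
Definition best_denominators (R : realType) (n : nat)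
    (dot : {dot 'rV[R]_n for idfun}) (alpha : 'rV[R]_n) (q : nat -> nat) : Prop :=
  (forall i j : nat, (0 < i)%N -> (i < j)%N -> (q i < q j)%N) /\
  (forall m : nat,
     best_denominator dot alpha m <-> exists2 k : nat, (0 < k)%N & q k = m).

Section DeltaIsMinimum.
Variables (R : realType) (n : nat) (dot : {dot 'rV[R]_n for idfun}).
Implicit Types (x y v alpha : 'rV[R]_n).

Lemma dot_ge0 x : 0 <= dot x x.
Proof.
have [->|x0] := eqVneq x 0; first by rewrite linear0l.
by rewrite ltW// neq0_dnorm_gt0.
Qed.

Lemma dotC x y : dot x y = dot y x.
Proof. by rewrite hermC /= expr0 mul1r. Qed.

Lemma dot_abs_le x v : `|dot x v| <= (dot x x + dot v v) / 2.
Proof.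
have hD := dot_ge0 (x + v); have hB := dot_ge0 (x - v).
move: hD hB; rewrite hnormD hnormB /= expr0 !mul1r => hD hB.
by rewrite ler_norml; apply/andP; split; lra.
Qed.

Lemma coord_dot (i : 'I_n) : exists v, forall x, x 0 i = dot x v.
Proof.
pose e (k : 'I_n) : 'rV[R]_n := delta_mx 0 k.
pose G : 'M[R]_n := \matrix_(k, l) dot (e k) (e l).
have dotE x y : dot x y = (x *m G *m y^T) 0 0.
  rewrite {1}(row_sum_delta x) {1}(row_sum_delta y) linear_sumr /= mxE.
  apply: eq_bigr => l _; rewrite linearZr_LR linear_sumlz /= mxE mulrC.
  rewrite mxE; congr (_ * _); apply: eq_bigr => k _.
  by rewrite linearZl_LR /= mxE.
have Gu : G \in unitmx.
  rewrite -row_free_unit -kermx_eq0; apply/eqP/row_matrixP => k.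
  rewrite row0; apply/eqP; apply: contraTT (lexx (0 : R)) => u0.
  rewrite -ltNge; have := @neq0_dnorm_gt0 _ _ _ dot _ u0.
  by rewrite dotE -row_mul mulmx_ker row0 mul0mx mxE.
exists (invmx G *m (e i)^T)^T => x.
by rewrite dotE trmxK mulmxA mulmxK// trmx_delta -colE mxE.
Qed.

Lemma lattice_dists_has_min alpha (q : nat) : exists p0 : 'rV[int]_n,
  forall p : 'rV[int]_n,
    inner_norm dot (q%:R *: alpha - map_mx intr p0) <=
    inner_norm dot (q%:R *: alpha - map_mx intr p).
Proof.
have coord_bound (i : 'I_n) : exists N : nat, forall p : 'rV[int]_n,
    inner_norm dot (q%:R *: alpha - map_mx intr p) <=
    inner_norm dot (q%:R *: alpha - map_mx intr (0 : 'rV[int]_n)) ->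
    (`|p 0%R i| <= N)%N.
  have [v vE] := coord_dot i; set a := q%:R *: alpha.
  set z := a - map_mx intr (0 : 'rV[int]_n).
  pose b := `|a 0 i| + (dot z z + dot v v) / 2.
  exists (Num.Def.archi_bound b) => p; rewrite ler_sqrt ?dot_ge0// => le_pz.
  have le_pb : `|(p 0 i)%:~R : R| <= b.
    have -> : (p 0 i)%:~R = a 0 i - (a - map_mx intr p) 0 i.
      by rewrite [X in _ - X]mxE [in X in _ - (_ + X)]mxE !mxE; lra.
    apply: le_trans (ler_normB _ _) _; rewrite lerD2l vE.
    by apply: le_trans (dot_abs_le _ _) _; lra.
  have := le_lt_trans le_pb (archi_boundP (le_trans (normr_ge0 _) le_pb)).
  by rewrite -intr_norm -natr_absz ltr_nat => /ltnW.
have [N NP] := fin_all_exists coord_bound.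
pose M := (\max_(i < n) N i)%N.
pose pt (f : {ffun 'I_n -> 'I_(M + M).+1}) : 'rV[int]_n :=
  \row_i ((f i)%:Z - M%:Z).
pose f0 : {ffun 'I_n -> 'I_(M + M).+1} := [ffun=> inord M].
have pt0 : pt f0 = 0.
  by apply/rowP => i; rewrite !mxE ffunE inordK ?subrr// ltnS leq_addr.
pose F f := inner_norm dot (q%:R *: alpha - map_mx intr (pt f)).
exists (pt [arg min_(f < f0) F f]%O).
case: arg_minP => // f1 _ min_f1 p.
have [le_p|/ltW lt_p] := leP (inner_norm dot (q%:R *: alpha - map_mx intr p))
  (inner_norm dot (q%:R *: alpha - map_mx intr (0 : 'rV[int]_n))); last first.
  by apply: le_trans lt_p; rewrite -pt0; apply: min_f1.
have le_pM i : (`|p 0%R i| <= M)%N.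
  by apply: leq_trans (NP i p le_p) _; apply: (leq_bigmax (F := N)).
suff -> : p = pt [ffun i => inord `|(p 0 i + M%:Z)%R|%N] by apply: min_f1.
apply/rowP => i; rewrite mxE ffunE inordK; have := le_pM i; lia.
Qed.

Lemma delta_le alpha (q : nat) (p : 'rV[int]_n) :
  delta dot alpha q <= inner_norm dot (q%:R *: alpha - map_mx intr p).
Proof.
apply: ge_inf; last by exists p.
by exists 0 => _ [p' _ <-]; apply: sqrtr_ge0.
Qed.

Lemma delta_attained alpha (q : nat) : exists p : 'rV[int]_n,
  delta dot alpha q = inner_norm dot (q%:R *: alpha - map_mx intr p).
Proof.
have [p pP] := lattice_dists_has_min alpha q; exists p.
apply/eqP; rewrite eq_le delta_le /=; apply: lb_le_inf; first by eexists; exists p.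
by move=> _ [p' _ <-].
Qed.

Lemma best_denominator1 alpha : best_denominator dot alpha 1.
Proof. by split=> // -[]. Qed.

Lemma best_denominators_1 alpha (q : nat -> nat) :
  best_denominators dot alpha q -> q 1%N = 1%N.
Proof.
move=> [q_incr qP]; have [k k_gt0 qk] := (qP 1%N).1 (best_denominator1 alpha).
have [q1_gt0 _] : best_denominator dot alpha (q 1%N) by apply/qP; exists 1%N.
case: (eqVneq k 1%N) qk => [->//|k_neq1] qk.
have := q_incr 1%N k isT; rewrite qk; lia.
Qed.
End DeltaIsMinimum.

(* Main.v *)
Require Import Defs.
From mathcomp Require Import all_boot all_order all_algebra.
From mathcomp Require Import sesquilinear classical_sets reals.
From mathcomp Require Import boolp zify lra.

Set Implicit Arguments.
Unset Strict Implicit.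
Unset Printing Implicit Defensive.

Import Order.TTheory GRing.Theory Num.Theory.

Local Open Scope ring_scope.

(** Write a lattice point of Z^(n+1) as v = (t, p), with height t and error
    xi v = t alpha - p, and let v_i be a lattice point of height q_i whose
    error is shortest, so that |xi v_i| = delta q_i.  Put m = 2^n and
    h = k + 2^(n-1), and suppose that the inequality fails.

    Parity: if v_i and v_j are congruent mod 2 with i < j, then (v_j - v_i)/2
    is a lattice point of positive height whose error is shorter than that of
    v_i, so its height is at least q_(i+1) and q_j >= q_i + 2 q_(i+1)
    ([best_congruent_mod2]).  Hence v_k, ..., v_(k+m) have distinct classes mod
    2; these classes are nonzero because a best approximation is not twice
    another lattice point.

    Counting: these 2^n + 1 classes fill more than half of the group
    F_2^(n+1), so they contain a line {g, y, g + y}.  The 2^(n-1) + 1 classes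
    of v_h, ..., v_(k+m) fill more than a quarter, so two of them differ by an
    element of the four-group {0, g, y, g + y} ([sum_of_two_in_large_set]).
    This gives three distinct indices a < b < c, at least two of them at
    least h, with v_a + v_b + v_c = 2u even.

    Geometry: then q_c >= q_a + q_b ([best_even_triple]), which is at least
    q_k + q_h, a contradiction.  Indeed, if q_c < q_a + q_b, the lattice points
    x = u - v_a, y = u - v_b, z = u - v_c have heights 0 < q(x) < q_b and
    0 < q(y), q(z) < q_a, so that their errors are longer than those of v_b,
    v_a, v_a respectively.  This contradicts the identity
      |x+y+z|^2 + |x|^2 + |y|^2 + |z|^2 = |y+z|^2 + |x+z|^2 + |x+y|^2,
    which is where the inner product is used. *)

(** * Large sets in elementary abelian 2-groups *)

(** A set with more than half of the elements meets each of its translates. *)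
Lemma large_set_difference (V : finZmodType) (B : {set V}) (y : V) :
  (#|V| < 2 * #|B|)%N -> exists b c, [/\ b \in B, c \in B & b = c + y].
Proof.
move=> cardB; pose By := [set c + y | c in B].
have cardBy : #|By| = #|B| by apply: card_imset; apply: addIr.
have /finset.set0Pn [b /finset.setIP [bB /finset.imsetP [c cB bE]]] :
    B :&: By != finset.set0.
  rewrite -card_gt0; have := cardsUI B By.
  have : (#|B :|: By| <= #|V|)%N := max_card _.
  rewrite cardBy; lia.
by exists b, c.
Qed.

(** In an elementary abelian 2-group, if A avoids 0 and has more than half of
    the elements, and T has more than a quarter of them, then the sum of some
    two elements of T lies in A. *)
Lemma sum_of_two_in_large_set (V : finZmodType) (A T : {set V}) :
  (forall x : V, x + x = 0) -> 0 \notin A ->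
  (#|V| < 2 * #|A|)%N -> (#|V| < 4 * #|T|)%N ->
  exists t s, [/\ t \in T, s \in T & t + s \in A].
Proof.
move=> xx0 A0 cardA cardT.
have addK (x y : V) : x + y + y = x by rewrite -addrA xx0 addr0.
have [g gA] : exists g, g \in A.
  by apply/finset.set0Pn; rewrite -card_gt0; move: cardA; case: #|A|.
(* A line {g, y, z} inside A. *)
have [z [y [zA yA zE]]] := large_set_difference g cardA.
have [/finset.set0Pn [b /finset.setIP [bT /finset.imsetP [c cT bE]]]|disj] :=
    boolP (T :&: [set c + g | c in T] != finset.set0).
  by exists b, c; split=> //; rewrite bE addrAC xx0 add0r.
(* Otherwise T and T + g are disjoint, and their union fills more than half
   of the group. *)
have [] := @large_set_difference V (T :|: [set c + g | c in T]) y.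
  have cardTg : #|[set c + g | c in T]| = #|T|.
    by apply: card_imset; apply: addIr.
  rewrite cardsU cardTg; move: disj; rewrite negbK => /eqP ->.
  rewrite cards0; lia.
move=> b [c [bT cT bE]].
have bc : b + c = y by rewrite bE addrAC xx0 add0r.
case/finset.setUP: bT bc => [bT|/finset.imsetP [b' b'T ->]];
  case/finset.setUP: cT => [cT|/finset.imsetP [c' c'T ->]] bc.
- by exists b, c; rewrite bc.
- exists b, c'; split=> //; suff -> : b + c' = z by [].
  by rewrite zE -bc addrA addK.
- exists b', c; split=> //; suff -> : b' + c = z by [].
  by rewrite zE -bc addrAC addK.
- exists b', c'; split=> //; suff -> : b' + c' = y by [].
  by rewrite -bc addrACA xx0 addr0.
Qed.

(** * Lattice points and their errors *)

Lemma even_row_int (m : nat) (v : 'rV[int]_m) :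
  map_mx intr v = 0 :> 'rV['F_2]_m -> exists u, v = u + u.
Proof.
move=> v0; exists (\row_i (v 0%R i %/ 2)%Z); apply/rowP => i.
have /eqP : ((v 0 i)%:~R : 'F_2) = 0 by have /rowP/(_ i) := v0; rewrite !mxE.
rewrite -(dvdz_pcharf (pchar_Fp (isT : prime 2))) !mxE.
by move=> /divzK; lia.
Qed.

(** The height t of the lattice point (t, p) of Z^(n+1). *)
Definition height (n : nat) (v : 'rV[int]_(1 + n)) : int := lsubmx v 0 0.

(** The error t alpha - p of the lattice point (t, p). *)
Definition err (R : realType) (n : nat) (alpha : 'rV[R]_n)
    (v : 'rV[int]_(1 + n)) : 'rV[R]_n :=
  (height v)%:~R *: alpha - map_mx intr (rsubmx v).

Lemma heightD (n : nat) (v w : 'rV[int]_(1 + n)) :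
  height (v + w) = height v + height w.
Proof. by rewrite /height !mxE. Qed.

Lemma heightB (n : nat) (v w : 'rV[int]_(1 + n)) :
  height (v - w) = height v - height w.
Proof. by rewrite /height !mxE. Qed.

Section Errors.
Variables (R : realType) (n : nat) (dot : {dot 'rV[R]_n for idfun}).
Variable alpha : 'rV[R]_n.
Implicit Types (x y z : 'rV[R]_n) (u v w : 'rV[int]_(1 + n)) (t q : nat).

Local Notation xi := (err alpha).

(** The squared norm; inequalities between errors are stated for it. *)
Local Notation sqn x := (dot x x).

Lemma errD v w : xi (v + w) = xi v + xi w.
Proof.
rewrite /err heightD linearD map_mxD rmorphD scalerDl opprD.
by rewrite addrACA.
Qed.

Lemma dotDl x y z : dot (x + y) z = dot x z + dot y z.
Proof. exact: linearDl. Qed.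

Lemma sqnD x y : sqn (x + y) = sqn x + sqn y + 2 * dot x y.
Proof. by rewrite hnormD /= expr0 mul1r; lra. Qed.

Lemma sqn_add_self x : sqn (x + x) = 4 * sqn x.
Proof. rewrite sqnD; lra. Qed.

Lemma sqn_sub_le x y : sqn (y - x) <= 2 * (sqn x + sqn y).
Proof.
have := dot_ge0 dot (y + x); rewrite hnormB /= expr0 mul1r sqnD; lra.
Qed.

Lemma sqn_add3 x y z :
  sqn (x + y + z) + sqn x + sqn y + sqn z =
  sqn (y + z) + sqn (x + z) + sqn (x + y).
Proof. rewrite !sqnD dotDl; lra. Qed.

Lemma delta_ge0 t : 0 <= delta dot alpha t.
Proof. by have [p ->] := delta_attained dot alpha t; apply: sqrtr_ge0. Qed.

Lemma delta_sqr_le v t : height v = t -> delta dot alpha t ^+ 2 <= sqn (xi v).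
Proof.
move=> vt; rewrite -(sqr_sqrtr (dot_ge0 dot (xi v))).
rewrite ler_pXn2r ?nnegrE ?delta_ge0 ?sqrtr_ge0 //.
by have := delta_le dot alpha t (rsubmx v); rewrite /err vt.
Qed.

(** [best_vector v q]: q is a best denominator, and v is a lattice point of
    height q whose error has the least norm delta q. *)
Definition best_vector v q : Prop :=
  [/\ best_denominator dot alpha q, height v = q
    & sqn (xi v) = delta dot alpha q ^+ 2].

Lemma best_vector_exists q :
  best_denominator dot alpha q -> exists v, best_vector v q.
Proof.
move=> qbest; have [p pE] := delta_attained dot alpha q.
have hE : height (row_mx (q%:Z)%:M p) = q by rewrite /height row_mxKl mxE eqxx.
exists (row_mx (q%:Z)%:M p); split=> //.
by rewrite pE sqr_sqrtr ?dot_ge0 // /err hE row_mxKr.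
Qed.

(** Lattice points of positive height below that of a best approximation have
    longer errors. *)
Lemma best_vector_lt v q w :
  best_vector v q -> 0 < height w -> height w < q%:Z ->
  sqn (xi v) < sqn (xi w).
Proof.
move=> [[q_gt0 qmin] _ ->] w_gt0 w_lt.
have wE : height w = `|height w|%N by lia.
apply: lt_le_trans (delta_sqr_le wE).
rewrite ltr_pXn2r ?nnegrE ?delta_ge0 //; apply: qmin; lia.
Qed.

Lemma best_vector_not_even v q u : best_vector v q -> v <> u + u.
Proof.
move=> vbest vE; have [[q_gt0 _] hv _] := vbest.
have hu : height v = height u + height u by rewrite vE heightD.
have /(best_vector_lt vbest) : 0 < height u by lia.
have -> : height u < q by lia.
move/(_ isT); rewrite vE errD sqn_add_self; have := dot_ge0 dot (xi u); lra.
Qed.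

(** This is the only place where three lattice points are compared at once.
    If c < a + b, the half-differences x, y, z of the proof all have positive
    heights that are too small for the norms of their errors. *)
Lemma best_even_triple va vb vc u (a b c : nat) :
  best_vector va a -> best_vector vb b -> best_vector vc c ->
  (a < b)%N -> (b < c)%N -> va + vb + vc = u + u -> (a + b <= c)%N.
Proof.
move=> abest bbest cbest ab bc uE; rewrite leqNgt; apply/negP => c_lt.
have [[a_gt0 _] ha _] := abest; have [_ hb _] := bbest; have [_ hc _] := cbest.
have hu : height u + height u = (a + b + c)%N.
  by rewrite -heightD -uE !heightD ha hb hc; lia.
pose x := u - va; pose y := u - vb; pose z := u - vc.
have [hx hy hz] : [/\ height x = height u - a%:Z, height y = height u - b%:Z
  & height z = height u - c%:Z] by rewrite !heightB ha hb hc.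
have Ea : va = y + z by rewrite addrACA -opprD -uE -[va + _ + _]addrA addrK.
have Eb : vb = x + z 
  by rewrite addrACA -opprD -uE (addrC va) -[vb + _ + _]addrA addrK.
have Ec : vc = x + y by rewrite addrACA -opprD -uE addrAC subrr add0r.
have x_gt : sqn (xi vb) < sqn (xi x) by apply: (best_vector_lt bbest); lia.
have y_gt : sqn (xi va) < sqn (xi y) by apply: (best_vector_lt abest); lia.
have z_gt : sqn (xi va) < sqn (xi z) by apply: (best_vector_lt abest); lia.
have c_le : sqn (xi vc) < sqn (xi va).
  by apply: (best_vector_lt cbest); lia.
have := sqn_add3 (xi x) (xi y) (xi z).
have := dot_ge0 dot (xi x + xi y + xi z).
rewrite -(errD y) -(errD x z) -(errD x y) -Ea -Eb -Ec; lra.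
Qed.

Variable q : nat -> nat.
Hypothesis q_best : best_denominators dot alpha q.

Lemma best_denominators_leq i j : (0 < i)%N -> (i <= j)%N -> (q i <= q j)%N.
Proof.
move=> i_gt0; rewrite leq_eqVlt => /predU1P [->//|ij].
by apply: ltnW; apply: q_best.1.
Qed.

Lemma best_denominators_best i :
  (0 < i)%N -> best_denominator dot alpha (q i).
Proof. by move=> i_gt0; apply/q_best.2; exists i. Qed.

Lemma delta_before_next i t : (0 < i)%N -> (0 < t)%N -> (t < q i.+1)%N ->
  delta dot alpha (q i) <= delta dot alpha t.
Proof.
move=> i_gt0; elim/ltn_ind: t => t IH t_gt0 t_lt.
have [/q_best.2 [l l_gt0 lE]|tN] := pselect (best_denominator dot alpha t).
  have li : (l <= i)%N.
    rewrite leqNgt; apply/negP => /(best_denominators_leq (ltn0Sn i)); lia.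
  move: li; rewrite leq_eqVlt => /predU1P [<-|li]; first by rewrite lE.
  apply: ltW; apply: (best_denominators_best i_gt0).2 => //.
  by rewrite -lE; apply: q_best.1.
have [s [s_gt0 st ds]] : exists s, [/\ (0 < s)%N, (s < t)%N
    & delta dot alpha s <= delta dot alpha t].
  apply: contrapT => noS; apply: tN; split=> // s s_gt0 st.
  by rewrite ltNge; apply/negP => ds; apply: noS; exists s.
by apply: le_trans ds; apply: IH => //; apply: ltn_trans t_lt.
Qed.

(** A lattice point of positive height that improves on the i-th best
    approximation has height at least q (i + 1). *)
Lemma next_le_height i v w : (0 < i)%N -> best_vector v (q i) ->
  0 < height w -> sqn (xi w) < sqn (xi v) -> (q i.+1)%:Z <= height w.
Proof.
move=> i_gt0 [_ _ ->] w_gt0 w_lt; rewrite leNgt; apply/negP => w_small.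
have wE : height w = `|height w|%N by lia.
move: w_lt; rewrite ltNge => /negP; apply; apply: le_trans (delta_sqr_le wE).
by rewrite ler_pXn2r ?nnegrE ?delta_ge0 //; apply: delta_before_next; lia.
Qed.

Lemma best_congruent_mod2 i j vi vj u : (0 < i)%N -> (i < j)%N ->
  best_vector vi (q i) -> best_vector vj (q j) -> vi + vj = u + u ->
  (q i + 2 * q i.+1 <= q j)%N.
Proof.
move=> i_gt0 ij ibest jbest uE.
have [_ hi Ni] := ibest; have [_ hj Nj] := jbest; have [[q_gt0 _] _ _] := ibest.
have qij := q_best.1 _ _ i_gt0 ij.
pose w := u - vi; have wE : vj = w + w + vi.
  by rewrite /w addrACA -uE addrA subrK addrAC subrr add0r.
have hw : height w + height w = (q j)%:Z - (q i)%:Z.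
  by rewrite -hi -hj wE !heightD addrK.
have : (q i.+1)%:Z <= height w.
  apply: (next_le_height i_gt0 ibest); first lia.
  have := sqn_sub_le (xi vi) (xi vj).
  have -> : xi vj - xi vi = xi w + xi w by rewrite wE !errD addrK.
  rewrite sqn_add_self.
  have : sqn (xi vj) < sqn (xi vi) by apply: (best_vector_lt jbest); lia.
  lra.
lia.
Qed.

End Errors.

(** * Growth of the best denominators *)

Theorem theorem1 (R : realType) (n : nat) (n_ge2 : (2 <= n)%N)
    (dot : {dot 'rV[R]_n for idfun}) (alpha : 'rV[R]_n)
    (alpha_irr : ~ rational_point alpha)
    (q : nat -> nat) (q_best : best_denominators dot alpha q)
    (k : nat) (k_ge1 : (1 <= k)%N) :
  (q (k + 2 ^ n) >= q k + minn (q (k + 2 ^ n.-1)) (2 * q k.+1))%N.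
Proof.
rewrite leqNgt; apply/negP => q_lt.
set h := (k + 2 ^ n.-1)%N in q_lt.
have pow2 : (2 ^ n = 2 * 2 ^ n.-1)%N by rewrite -expnS prednK //; lia.
have q_mono i j : (k <= i)%N -> (i <= j)%N -> (q i <= q j)%N.
  by move=> ki; apply: (best_denominators_leq q_best); lia.
have [v vP] :
    {v & forall i, (0 < i)%N -> best_vector dot alpha (v i) (q i)}.
  apply: (@boolp.choice _ _
    (fun i w => (0 < i)%N -> best_vector dot alpha w (q i))) => i.
  have [->|i_gt0] := posnP i; first by exists 0.
  have [w wP] := best_vector_exists (best_denominators_best q_best i_gt0).
  by exists w.
have vbest i : (k <= i)%N -> best_vector dot alpha (v i) (q i).
  by move=> ki; apply: vP; lia.
(* The class of a lattice point mod 2. *)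
pose cls w : 'rV['F_2]_(1 + n) := map_mx intr w.
have clsD w w' : cls (w + w') = cls w + cls w' by rewrite /cls map_mxD.
have xx0 (x : 'rV['F_2]_(1 + n)) : x + x = 0.
  by apply/rowP => i; rewrite !mxE -mulr2n mulrn_pchar // pchar_Fp.
have cls_neq0 i : (k <= i)%N -> cls (v i) <> 0.
  by move=> ki /even_row_int [u]; apply: best_vector_not_even (vbest i ki).
have cls_lt_neq i j : (k <= i)%N -> (i < j)%N -> (j <= k + 2 ^ n)%N ->
    cls (v i) <> cls (v j).
  move=> ki ij jle eq_cls.
  have /even_row_int [u uE] : cls (v i + v j) = 0 by rewrite clsD eq_cls xx0.
  have i_gt0 : (0 < i)%N by lia.
  have kj : (k <= j)%N by lia.
  have := best_congruent_mod2 q_best i_gt0 ij (vbest i ki) (vbest j kj) uE.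
  have := q_mono _ _ kj jle; have := q_mono _ _ (leqnn k) ki.
  have := q_mono k.+1 i.+1 (leqnSn k) ki; lia.
have cls_inj i j : (k <= i <= k + 2 ^ n)%N -> (k <= j <= k + 2 ^ n)%N ->
    cls (v i) = cls (v j) -> i = j.
  move=> ile jle eq_cls; have [ij|ji|//] := ltngtP i j.
    by case: (@cls_lt_neq i j); rewrite // ?eq_cls; lia.
  by case: (@cls_lt_neq j i); rewrite // ?eq_cls; lia.
(* [best_even_triple] with the middle index at least h. *)
have no_triple a b c : (k <= a)%N -> (a < b)%N -> (h <= b)%N -> (b < c)%N ->
    (c <= k + 2 ^ n)%N -> cls (v a) + cls (v b) + cls (v c) = 0 -> False.
  move=> ka ab hb bc cle; rewrite -!clsD => /even_row_int [u uE].
  have [kb kc] : (k <= b)%N /\ (k <= c)%N by lia.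
  have q_lt_q x y : (k <= x)%N -> (x < y)%N -> (q x < q y)%N.
    by move=> kx; apply: q_best.1; lia.
  have := best_even_triple (vbest a ka) (vbest b kb) (vbest c kc)
    (q_lt_q a b ka ab) (q_lt_q b c kb bc) uE.
  have kh : (k <= h)%N := leq_addr _ _.
  have := q_mono _ _ (leqnn k) ka; have := q_mono _ _ kh hb.
  have := q_mono _ _ kc cle; lia.
pose A := [set cls (v (k + i)%N) | i : 'I_(2 ^ n).+1].
pose T := [set cls (v (h + i)%N) | i : 'I_(2 ^ n.-1).+1].
have cardV : #|'rV['F_2]_(1 + n)| = (2 * 2 ^ n)%N.
  by rewrite card_mx card_Fp // mul1n expnS.
have cardA : #|A| = (2 ^ n).+1.
  rewrite card_imset ?card_ord // => i j /cls_inj eq_ij; apply: ord_inj.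
  by have := ltn_ord i; have := ltn_ord j; lia.
have cardT : #|T| = (2 ^ n.-1).+1.
  rewrite card_imset ?card_ord // => i j /cls_inj eq_ij; apply: ord_inj.
  by have := ltn_ord i; have := ltn_ord j; lia.
have A0 : 0 \notin A.
  apply/finset.imsetP => -[i _ /esym]; apply: cls_neq0; lia.
have [t [s [/finset.imsetP [i _ ->] /finset.imsetP [j _ ->]]]] :
    exists t s, [/\ t \in T, s \in T & t + s \in A].
  by apply: sum_of_two_in_large_set => //; rewrite cardV ?cardA ?cardT; lia.
case/finset.imsetP => l _.
have lei : (h <= h + i <= k + 2 ^ n)%N by have := ltn_ord i; lia.
have lej : (h <= h + j <= k + 2 ^ n)%N by have := ltn_ord j; lia.
have lel : (k <= k + l <= k + 2 ^ n)%N by have := ltn_ord l; lia.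
move: (h + i)%N (h + j)%N (k + l)%N lei lej lel => {}i {}j {}l lei lej lel eqs.
have {}eqs : cls (v i) + cls (v j) + cls (v l) = 0 by rewrite eqs xx0.
have il : i <> l.
  move=> il; move: eqs; rewrite il addrAC xx0 add0r; apply: cls_neq0; lia.
have jl : j <> l.
  move=> jl; move: eqs; rewrite jl -addrA xx0 addr0; apply: cls_neq0; lia.
have ij : i <> j.
  move=> ij; move: eqs; rewrite ij xx0 add0r; apply: cls_neq0; lia.
wlog lt_ij : i j lei lej eqs il jl ij / (i < j)%N => [wl|].
  have [lt_ij|lt_ji|//] := ltngtP i j; first exact: (wl i j).
  by apply: (wl j i) => //; [rewrite (addrC (cls (v j))) | move/esym].
(* Since i and j are at least h, so is the middle one of i, j, l. *)
have [lt_li|lt_il|li] := ltngtP l i; last by case: il.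
  apply: (no_triple l i j); rewrite -?eqs //; try lia.
  by rewrite -addrA addrC.
have [lt_lj|lt_jl|lj] := ltngtP l j; last by case: jl.
  by apply: (no_triple i l j); rewrite -?eqs 1?addrAC //; lia.
by apply: (no_triple i j l); rewrite -?eqs //; lia.
Qed.
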